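(* Let $\mathcal K$ be a set consisting of asymptotically complete, closed, partially ordered semirings. Suppose that $S$ is a preordered semiring of polynomial growth such that for all $a,b\in S$ the asymptotic inequality $a\lesssim b$ is equivalent to the collection of inequalities $\phi(a)\le\phi(b)$ for all $\mathbb K\in\mathcal K$ and all $\phi\in\operatorname{Hom}(S,\mathbb K)$. Let $\overline S$ be the asymptotic completion of $S$, and let $a,b\in\overline S$ be such that $a\sim b$. Then $a\le b$ is equivalent to the collection of inequalities $\psi(a)\le\psi(b)$ for all $\mathbb K\in\mathcal K$ and all $\psi\in\operatorname{Hom}(\overline S,\mathbb K)$.
   Context: Semirings are commutative, with $0$ and $1$. A preordered semiring is a semiring $S$ with a reflexive transitive relation $\le$ such that $x\le y$ implies $z+x\le z+y$ and $zx\le zy$ for all $x,y,z\in S$; it is a partially ordered semiring if $\le$ is also antisymmetric. $\operatorname{Hom}(S,T)$ is the set of monotone semiring homomorphisms $S\to T$ (preserving $0,1,+,\cdot$ and the preorder). The relation $\sim$ is the equivalence relation generated by $\le$. A nonzero element $u\in S$ is power universal if $1\le u$ and for all nonzero $x,y\in S$ with $x\le y$ there is $k\in\mathbb N$ with $y\le u^kx$; $S$ is of polynomial growth if it has a power universal element. All preordered semirings (including those in $\mathcal K$) are assumed to be of polynomial growth, with a fixed power universal element $u$ (the notions below do not depend on the choice). $\mathbb N$ includes $0$. A sublinear sequence is a sequence $(k_n)_{n\in\mathbb N}$ in $\mathbb N$ with $\lim_{n\to\infty}k_n/n=0$. For $a,b\in S^{\mathbb N}$: $(a\oplus b)_n=\sum_{m=0}^n\binom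 nm a_{n-m}b_m$; $(a\odot b)_n=a_nb_n$; $a\lesssim b$ means that there is a sublinear sequence $(k_n)$ with $a_n\le u^{k_n}b_n$ for all $n\in\mathbb N$; $a\approx b$ means $a\lesssim b$ and $b\lesssim a$. For $s\in S$, $G(s)=(1,s,s^2,\dots)$. For elements $x,y\in S$, the asymptotic preorder is $x\lesssim y$ iff $G(x)\lesssim G(y)$, i.e. $x^n\le u^{k_n}y^n$ for all $n$ and some sublinear $(k_n)$. $S$ is closed if $x\lesssim y$ implies $x\le y$ for all $x,y\in S$. A sequence $a\in S^{\mathbb N}$ is approximately geometric if either $a\approx G(0)$, or $a_n\ne0$ for all $n$ and there is a sublinear sequence $(k_n)$ such that for all $t\in\mathbb N_{>0}$ and $n_1,\dots,n_t\in\mathbb N$ both $a_{n_1}\cdots a_{n_t}\le u^{k_{n_1}+\dots+k_{n_t}}a_{n_1+\dots+n_t}$ and $a_{n_1+\dots+n_t}\le u^{k_{n_1}+\dots+k_{n_t}}a_{n_1}\cdots a_{n_t}$ hold. $S$ is asymptotically complete if for every approximately geometric sequence $a\in(S\setminus\{0\})^{\mathbb N}$ there is $s\in S$ with $a\approx G(s)$. An asymptotic completion of $S$ is a closed, asymptotically complete partially ordered semiring $\overline S$ with a monotone homomorphism $i:S\to\overline S$ such that $i(u)$ is power universal and every monotone homomorphism $f$ from $S$ to an asymptotically complete closed partially ordered semiring $T$ factors uniquely as $f=g\circ i$ with $g:\overline S\to T$ a monotone homomorphism. It is unique up to isomorphism, and is realized by the set of $\approx$-classes $[a]$ of approximately geometric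 sequences in $S$, with addition, multiplication and order induced by $\oplus,\odot,\lesssim$, and $i(s)=[G(s)]$. *)

(* Defs.v *)
From HB Require Import structures.
From Stdlib Require Export Relation_Operators.
From mathcomp Require Export all_boot all_order all_algebra.
From mathcomp Require Export boolp classical_sets filter reals.
From mathcomp Require Export topology normedtype Rstruct.

Set Implicit Arguments.
Unset Strict Implicit.
Unset Printing Implicit Defensive.

Export Order.TTheory GRing.Theory Num.Theory.
Export numFieldNormedType.Exports.

Local Open Scope classical_set_scope.
Local Open Scope ring_scope.

(* The order structures of the library cannot be joined with semirings here
   (they already meet the additive structures in [porderZmodType]), hence a
   separate [Prop]-valued preorder. *)
HB.mixin Record isPreorderedSemiRing S of GRing.ComPzSemiRing S := {
  sle : S -> S -> Prop;
  sle_refl : forall x, sle x x;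
  sle_trans : forall y x z, sle x y -> sle y z -> sle x z;
  sle_add2l : forall z x y, sle x y -> sle (z + x) (z + y);
  sle_mul2l : forall z x y, sle x y -> sle (z * x) (z * y)
}.

#[short(type="preorderedSemiRingType")]
HB.structure Definition PreorderedSemiRing :=
  { S of GRing.ComPzSemiRing S & isPreorderedSemiRing S }.

Notation "x <=p y" := (sle x y) (at level 70, y at next level) : ring_scope.

Definition power_universal (S : preorderedSemiRingType) (u : S) : Prop :=
  [/\ u != 0, 1 <=p u &
      forall x y : S, x != 0 -> y != 0 -> x <=p y ->
        exists k : nat, y <=p u ^+ k * x].

HB.mixin Record hasPowerUniversal S of PreorderedSemiRing S := {
  pu : S;
  puP : power_universal pu
}.

(* Preordered semirings of polynomial growth, with a fixed power universal
   element [pu]. *)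
#[short(type="pgSemiRingType")]
HB.structure Definition PolyGrowthSemiRing :=
  { S of PreorderedSemiRing S & hasPowerUniversal S }.

HB.mixin Record isPartiallyOrdered S of PreorderedSemiRing S := {
  sle_anti : forall x y : S, x <=p y -> y <=p x -> x = y
}.

#[short(type="pgPOSemiRingType")]
HB.structure Definition PolyGrowthPOSemiRing :=
  { S of PolyGrowthSemiRing S & isPartiallyOrdered S }.

HB.mixin Record isMonotone (S T : preorderedSemiRingType) (f : S -> T) := {
  sle_homo : forall x y, x <=p y -> f x <=p f y
}.

(* Homomorphisms need not preserve the power universal elements [pu]. *)
HB.structure Definition MonotoneHom (S T : preorderedSemiRingType) :=
  { f of @GRing.RMorphism S T f & isMonotone S T f }.

Notation Hom S T := (MonotoneHom.type S T).

Definition order_equiv (S : preorderedSemiRingType) : S -> S -> Prop :=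
  clos_refl_sym_trans S (@sle S).

(* The limit is taken in the real numbers, [^o] selecting their usual topology;
   the term at [n = 0] is irrelevant to it. *)
Definition sublinear (k : nat -> nat) : Prop :=
  ((k n)%:R / n%:R : Rdefinitions.R^o) @[n --> \oo] --> (0 : Rdefinitions.R^o).

Section Asymptotic.
Variable S : pgSemiRingType.
Implicit Types (a b : nat -> S) (s x y : S).

Definition seq_asymp_le a b : Prop :=
  exists2 k, sublinear k & forall n, a n <=p pu ^+ k n * b n.

Definition seq_asymp_eq a b : Prop := seq_asymp_le a b /\ seq_asymp_le b a.

Definition geometric_seq s : nat -> S := fun n => s ^+ n.

Definition asymp_le x y : Prop :=
  seq_asymp_le (geometric_seq x) (geometric_seq y).

Definition asymp_closed : Prop := forall x y, asymp_le x y -> x <=p y.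

Definition approx_geometric a : Prop :=
  seq_asymp_eq a (geometric_seq 0) \/
  ((forall n, a n != 0) /\
   exists2 k, sublinear k &
     forall (t : nat) (n : 'I_t -> nat), (0 < t)%N ->
       \prod_(j < t) a (n j)
         <=p pu ^+ (\sum_(j < t) k (n j))%N * a (\sum_(j < t) n j)%N /\
       a (\sum_(j < t) n j)%N
         <=p pu ^+ (\sum_(j < t) k (n j))%N * \prod_(j < t) a (n j)).

Definition asymp_complete : Prop :=
  forall a, (forall n, a n != 0) -> approx_geometric a ->
    exists s, seq_asymp_eq a (geometric_seq s).

End Asymptotic.

Arguments asymp_closed : clear implicits.
Arguments asymp_complete : clear implicits.

Record is_asymp_completion (S : pgSemiRingType) (Sbar : pgPOSemiRingType)
    (i : Hom S Sbar) : Prop := {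
  completion_closed : asymp_closed Sbar;
  completion_complete : asymp_complete Sbar;
  completion_power_universal : power_universal (i pu);
  completion_universal :
    forall T : pgPOSemiRingType, asymp_closed T -> asymp_complete T ->
    forall f : Hom S T,
      exists2 g : Hom Sbar T, f =1 g \o i &
        forall g' : Hom Sbar T, f =1 g' \o i -> g' =1 g
}.

(* Main.v *)
(* Write [u] for [i pu]. For every [a] in [Sbar] there are [x_n] in [S] such that
   [a ^+ n] and [i x_n] agree up to a factor [u ^+ k_n] with [k] sublinear.
   Indeed the elements having such approximations form a closed, asymptotically
   complete subsemiring containing the image of [i], which the universal property
   forces to be all of [Sbar]. Let [y_n] and [l_n] be the same for [b]. Since [k]
   and [l] do not depend on a homomorphism, [psi a <=p psi b] for all [psi] yields
   [phi x_n <=p phi (pu ^+ (k_n + l_n) * y_n)] for every [phi] on [S], as each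
   [phi] extends to [Sbar]. The hypothesis on [S], applied for each fixed [n],
   gives [i x_n <=p u ^+ (k_n + l_n) * i y_n]; hence [a ^+ n] is at most
   [b ^+ n] up to a sublinear power of [u], and [a <=p b] by closedness. *)
From HB Require Import structures.
Require Import Defs.
From mathcomp Require Import zify.

Set Implicit Arguments.
Unset Strict Implicit.
Unset Printing Implicit Defensive.

Local Open Scope ring_scope.

Local Arguments sle_trans {s y x z}.
Local Arguments sle_add2l {s} z {x y}.
Local Arguments sle_mul2l {s} z {x y}.
Local Arguments sle_anti {s x y}.

(** * Sublinear sequences of natural numbers *)

(** A division-free form of the limit: [p] plays the role of an inverse epsilon and [C] absorbs the
    finitely many initial terms. *)
Lemma sublinearP (k : nat -> nat) :
  sublinear k <-> forall p, exists C, forall n, (k n * p <= n + C)%N.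
Proof.
split=> [k0 p | kC].
- have p_gt0 : (0 : Rdefinitions.R) < p.+1%:R^-1 by rewrite invr_gt0 ltr0n.
  have /cvgrPdist_le/(_ _ p_gt0) [N _ kN] := k0.
  exists (\sum_(m < N.+1) k m * p)%N => n; have [nN | Nn] := leqP n N.
    rewrite (bigD1 (Ordinal (nN : n < N.+1)%N)) //=; lia.
  have := kN n (ltnW Nn); rewrite sub0r normrN ger0_norm ?divr_ge0 ?ler0n //.
  rewrite ler_pdivrMr ?ltr0n; last by lia.
  rewrite mulrC ler_pdivlMr ?ltr0n // -natrM ler_nat; lia.
- apply/cvgrPdist_le => e e_gt0.
  have [p [p_gt0 ep]] : exists p, (0 < p)%N /\ e^-1 <= p%:R.
    exists (Num.truncn e^-1).+1; split=> //; apply/ltW.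
    by rewrite truncnS_gt.
  (* The factor 2 absorbs [C]: once [C < n], the bound [n + C] is below [2 * n]. *)
  have [C kpC] := kC (2 * p)%N.
  exists C.+1 => // n /= Cn.
  rewrite sub0r normrN ger0_norm ?divr_ge0 ?ler0n //.
  have n_gt0 : (0 : Rdefinitions.R) < n%:R by rewrite ltr0n; lia.
  rewrite ler_pdivrMr //.
  have knp : (k n)%:R * p%:R <= n%:R :> Rdefinitions.R.
    by rewrite -natrM ler_nat; have := kpC n; lia.
  rewrite mulrC -ler_pdivrMr //; apply: le_trans knp.
  exact: ler_wpM2l.
Qed.

Lemma sublinear0 : sublinear (fun=> 0%N).
Proof. by apply/sublinearP => p; exists 0%N => n; rewrite mul0n. Qed.

Lemma sublinearD (k l : nat -> nat) :
  sublinear k -> sublinear l -> sublinear (fun n => k n + l n)%N.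
Proof.
move=> /sublinearP k0 /sublinearP l0; apply/sublinearP => p.
have [C kC] := k0 (2 * p)%N; have [C' lC] := l0 (2 * p)%N.
by exists (C + C')%N => n; have := kC n; have := lC n; lia.
Qed.

Lemma sublinearMr (c : nat) (k : nat -> nat) :
  sublinear k -> sublinear (fun n => c * k n)%N.
Proof.
move=> /sublinearP k0; apply/sublinearP => p.
by have [C kC] := k0 (c * p)%N; exists C => n; have := kC n; lia.
Qed.

(** The running maximum works because the bound [n + C] increases with [n]. *)
Lemma sublinear_majorant (k : nat -> nat) : sublinear k ->
  exists2 K, sublinear K & forall m n, (m <= n)%N -> (k m <= K n)%N.
Proof.
move=> /sublinearP k0; exists (fun n => \max_(m < n.+1) k m)%N; last first.
  by move=> m n; rewrite -ltnS => mn; apply: (leq_bigmax (Ordinal mn)).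
apply/sublinearP => p; have [C kC] := k0 p; exists C => n.
elim/big_ind: _ => [|x y xC yC|m _]; [by lia | by lia |].
by apply: leq_trans (kC m) _; rewrite leq_add2r -ltnS.
Qed.

(* The bound [P n k] may come from a different construction for each rate [p];
   taking the least [k] for every [n] merges them into one sequence. *)
Lemma sublinear_choice (P : nat -> nat -> Prop) :
  (forall p, exists C, forall n, exists2 k, P n k & (k * p <= n + C)%N) ->
  exists2 k, sublinear k & forall n, P n (k n).
Proof.
move=> Pk.
have exP n : exists k, `[< P n k >].
  by have [C /(_ n) [k Pnk _]] := Pk 0%N; exists k; apply/asboolP.
exists (fun n => ex_minn (exP n)); last first.
  by move=> n; case: ex_minnP => k /asboolP.
apply/sublinearP => p; have [C kC] := Pk p; exists C => n.
case: ex_minnP => k _ kmin; have [l Pl lC] := kC n.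
by apply: leq_trans lC; rewrite leq_mul2r kmin ?orbT //; apply/asboolP.
Qed.

(** * Order calculus and closeness up to powers of an element *)

Section PreorderedSemiRing.
Variable T : preorderedSemiRingType.
Implicit Types (u v x y z : T) (k l n : nat).

Lemma sle_mul x y z w : x <=p y -> z <=p w -> x * z <=p y * w.
Proof.
move=> xy zw; apply: sle_trans (sle_mul2l x zw) _.
by rewrite ![_ * w]mulrC; apply: sle_mul2l.
Qed.

Lemma sle_addlr x y z w : x <=p y -> z <=p w -> x + z <=p y + w.
Proof.
move=> xy zw; apply: sle_trans (sle_add2l x zw) _.
by rewrite ![_ + w]addrC; apply: sle_add2l.
Qed.

Lemma sle_exp n x y : x <=p y -> x ^+ n <=p y ^+ n.
Proof.
move=> xy; elim: n => [|n IHn]; first exact: sle_refl.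
by rewrite !exprS; apply: sle_mul.
Qed.

Lemma sle_sum (I : Type) (r : seq I) (P : pred I) (F G : I -> T) :
  (forall i, P i -> F i <=p G i) ->
  \sum_(i <- r | P i) F i <=p \sum_(i <- r | P i) G i.
Proof.
move=> FG; elim/big_ind2: _ => //; first exact: sle_refl.
by move=> x y z w; apply: sle_addlr.
Qed.

Lemma sle_exp2l u k l : 1 <=p u -> (k <= l)%N -> u ^+ k <=p u ^+ l.
Proof.
move=> u1 kl; rewrite -(subnKC kl) exprD -[X in X <=p _]mulr1.
apply: sle_mul2l; rewrite -(expr1n _ (l - k)); exact: sle_exp.
Qed.

(** A multiplicative distance bound. The base is a parameter because [i pu] may differ from the [pu]
    of the target. *)
Definition mul_close u k x y : Prop := x <=p u ^+ k * y /\ y <=p u ^+ k * x.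

Lemma mul_close_refl u x : mul_close u 0 x x.
Proof. by split; rewrite expr0 mul1r; apply: sle_refl. Qed.

Lemma mul_close_sym u k x y : mul_close u k x y -> mul_close u k y x.
Proof. by case. Qed.

Lemma mul_close_trans u k l y x z :
  mul_close u k x y -> mul_close u l y z -> mul_close u (k + l) x z.
Proof.
move=> [xy yx] [yz zy]; split.
  by apply: sle_trans xy _; rewrite exprD -mulrA; apply: sle_mul2l.
by apply: sle_trans zy _; rewrite addnC exprD -mulrA; apply: sle_mul2l.
Qed.

Lemma mul_closeM u k l x y z w : mul_close u k x y -> mul_close u l z w ->
  mul_close u (k + l) (x * z) (y * w).
Proof.
by move=> [xy yx] [zw wz]; split; rewrite exprD mulrACA; apply: sle_mul.
Qed.

Lemma mul_closeX u n k x y :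
  mul_close u k x y -> mul_close u (k * n) (x ^+ n) (y ^+ n).
Proof. by move=> [xy yx]; split; rewrite exprM -exprMn; apply: sle_exp. Qed.

Lemma mul_close_leq u k l x y :
  1 <=p u -> (k <= l)%N -> mul_close u k x y -> mul_close u l x y.
Proof.
move=> u1 kl [xy yx]; have ukl := sle_exp2l u1 kl.
split; [apply: sle_trans xy _ | apply: sle_trans yx _];
  by apply: sle_mul => //; apply: sle_refl.
Qed.

Lemma mul_close_sum u k (I : Type) (r : seq I) (P : pred I) (F G : I -> T) :
  (forall i, P i -> mul_close u k (F i) (G i)) ->
  mul_close u k (\sum_(i <- r | P i) F i) (\sum_(i <- r | P i) G i).
Proof.
by move=> FG; split; rewrite big_distrr /=; apply: sle_sum => i /FG [].
Qed.

Lemma mul_close_muln u k n x y :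
  mul_close u k x y -> mul_close u k (x *+ n) (y *+ n).
Proof.
by move=> xy; rewrite -(card_ord n) -!sumr_const; apply: mul_close_sum.
Qed.

Lemma mul_close_base u v c k x y :
  u <=p v ^+ c -> mul_close u k x y -> mul_close v (c * k) x y.
Proof.
move=> uv [xy yx]; have := sle_exp k uv; rewrite -exprM => uvk.
split; [apply: sle_trans xy _ | apply: sle_trans yx _];
  by apply: sle_mul => //; apply: sle_refl.
Qed.

Lemma power_universal_dominates u v :
  power_universal u -> power_universal v -> exists c, u <=p v ^+ c.
Proof.
move=> [u0 u1 _] [v0 v1 vP].
have n10 : (1 : T) != 0.
  by apply: contra_neq u0 => e; rewrite -[u]mulr1 e mulr0.
by have [c] := vP 1 u n10 u0 u1; rewrite mulr1; exists c.
Qed.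

End PreorderedSemiRing.

(** Each power universal element is below a power of any other, so changing the base only multiplies
    the exponents by a constant. *)
Lemma asymp_closed_base (T : pgPOSemiRingType) (u x y : T) (k : nat -> nat) :
  asymp_closed T -> power_universal u -> sublinear k ->
  (forall n, x ^+ n <=p u ^+ k n * y ^+ n) -> x <=p y.
Proof.
move=> closedT uP k0 xy; have [c uc] := power_universal_dominates uP puP.
apply: closedT; exists (fun n => c * k n)%N; first exact: sublinearMr.
move=> n; apply: sle_trans (xy n) _.
apply: sle_mul; last exact: sle_refl.
by rewrite exprM; apply: sle_exp.
Qed.

Lemma seq_asymp_eqP (T : pgSemiRingType) (a b : nat -> T) :
  seq_asymp_eq a b <->
  exists2 k, sublinear k & forall n, mul_close pu (k n) (a n) (b n).
Proof.
split=> [[[k k0 ab] [l l0 ba]] | [k k0 ab]]; last first.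
  by split; exists k => // n; have [] := ab n.
exists (fun n => k n + l n)%N; first exact: sublinearD.
have [_ pu1 _] := @puP T.
move=> n; split; [apply: sle_trans (ab n) _ | apply: sle_trans (ba n) _];
  by apply: sle_mul (sle_refl _); apply: sle_exp2l; rewrite // ?leq_addr ?leq_addl.
Qed.

(** * Elements approximable by the image of a homomorphism *)

Section Approximable.
Variables (S : pgSemiRingType) (T : preorderedSemiRingType) (i : Hom S T).
Implicit Types (x y : S) (a b s : T).

(** Boolean-valued, so that the sub-semiring structures of the library apply to it. *)
Definition approximable : {pred T} := fun a =>
  `[< exists2 k, sublinear k &
        forall n, exists x, mul_close (i pu) (k n) (a ^+ n) (i x) >].

Lemma approximableP a :
  reflect (exists2 k, sublinear k &
             forall n, exists x, mul_close (i pu) (k n) (a ^+ n) (i x))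
          (a \in approximable).
Proof. exact: asboolP. Qed.

Let ge1_ipu : 1 <=p i pu.
Proof. by rewrite -(rmorph1 i); apply: sle_homo; case: (@puP S). Qed.

Lemma approximable_image x : i x \in approximable.
Proof.
apply/approximableP; exists (fun=> 0%N); first exact: sublinear0.
by move=> n; exists (x ^+ n); rewrite rmorphXn; apply: mul_close_refl.
Qed.

Lemma approximableM a b :
  a \in approximable -> b \in approximable -> a * b \in approximable.
Proof.
move=> /approximableP [k k0 ax] /approximableP [l l0 bx].
apply/approximableP; exists (fun n => k n + l n)%N; first exact: sublinearD.
move=> n; have [x axn] := ax n; have [y byn] := bx n; exists (x * y).
by rewrite exprMn rmorphM; apply: mul_closeM.
Qed.

(** Expand [(a + b) ^+ n] binomially. The monotone majorants give all terms the common error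
    [K n + L n], and summing terms of equal error does not increase it. *)
Lemma approximableD a b :
  a \in approximable -> b \in approximable -> a + b \in approximable.
Proof.
move=> /approximableP [k /sublinear_majorant [K K0 kK]] /choice [x ax].
move=> /approximableP [l /sublinear_majorant [L L0 lL]] /choice [y by_].
apply/approximableP; exists (fun n => K n + L n)%N; first exact: sublinearD.
move=> n; exists (\sum_(m < n.+1) x (n - m)%N * y m *+ 'C(n, m)).
rewrite exprDn rmorph_sum /=; apply: mul_close_sum => m _.
rewrite rmorphMn rmorphM /=; apply: mul_close_muln.
have mn : (m <= n)%N by rewrite -ltnS.
apply: mul_close_leq (mul_closeM (ax _) (by_ _)) => //.
by rewrite leq_add ?kK ?lL ?leq_subr.
Qed.

Lemma approximable_semiring_closed : semiring_closed approximable.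
Proof.
split; split.
- by rewrite -(rmorph0 i) approximable_image.
- exact: approximableD.
- by rewrite -(rmorph1 i) approximable_image.
- exact: approximableM.
Qed.

(* To approximate [s ^+ n] at a given rate, fix [m] with [k m / m] small and
   write [n = m * q + r] with [r < m]: then [s ^+ n] is close to
   [d m ^+ q * d r], and [d m] is itself approximable. *)
Lemma approximable_limit (d : nat -> T) (k : nat -> nat) s :
  (forall n, d n \in approximable) -> sublinear k ->
  (forall n, mul_close (i pu) (k n) (s ^+ n) (d n)) -> s \in approximable.
Proof.
move=> dP /sublinearP k0 sd; apply/approximableP.
have /choice [l lP] : forall n, exists l, sublinear l /\
    forall q, exists x, mul_close (i pu) (l q) (d n ^+ q) (i x).
  by move=> n; have /approximableP [l l0 lP] := dP n; exists l.
apply: (sublinear_choice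
  (P := fun n k => exists x, mul_close (i pu) k (s ^+ n) (i x))) => p.
(* At [m = C.+1] the bound reads [k m * (4 * p) <= 2 * C + 1 < 2 * m], so replacing [q] blocks
   [s ^+ m] by [d m] uses at most half of the budget [n]. *)
have [C /(_ C.+1) kC] := k0 (4 * p)%N; set m := C.+1 in kC.
have [/sublinearP /(_ (2 * p)%N) [C' lC] lm] := lP m.
(* [E] bounds the error of the factor [s ^+ r] for every remainder [r < m], independently of [n]. *)
pose E := (\sum_(r < m) (k r + l r 1))%N.
exists (C' + E * p)%N => n; set q := (n %/ m)%N; set r := (n %% m)%N.
have r_lt : (r < m)%N by rewrite ltn_mod.
exists (k m * q + l m q + E)%N.
  have [x dx] := lm q; have [y dy] := (lP r).2 1%N; exists (x * y).
  have -> : s ^+ n = (s ^+ m) ^+ q * s ^+ r.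
    by rewrite -exprM -exprD mulnC -divn_eq.
  rewrite expr1 in dy; rewrite rmorphM.
  apply: mul_closeM; first exact: mul_close_trans (mul_closeX q (sd m)) dx.
  apply: mul_close_leq (mul_close_trans (sd r) dy) => //.
  by rewrite /E (bigD1 (Ordinal r_lt)) //= leq_addr.
have kmq : (k m * q * (2 * p) <= n)%N.
  have km : (k m * (2 * p) <= m)%N by rewrite /m in kC *; lia.
  rewrite mulnAC mulnC; apply: leq_trans (leq_mul (leqnn q) km) _.
  exact: leq_trunc_div.
have := lC q; have := leq_div n m; rewrite -/q; lia.
Qed.

End Approximable.

(** * Sub-semirings with the induced order *)

Section FullSubSemiRing.
Variables (T : pgPOSemiRingType) (P : {pred T}) (u : T).
Variables (P_closed : semiring_closed P) (uP : power_universal u).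
Variable Pu : u \in P.

(* The hypotheses are parameters of the type because its structures use them. *)
Definition sub_semiring of semiring_closed P & power_universal u & u \in P :=
  {x : T | P x}.
Local Notation U := (sub_semiring P_closed uP Pu).

HB.instance Definition _ := SubChoice.copy U {x : T | P x}.
HB.instance Definition _ :=
  GRing.SubChoice_isSubComPzSemiRing.Build T P U P_closed.

Fact sub_sle_refl (x : U) : val x <=p val x. Proof. exact: sle_refl. Qed.
Fact sub_sle_trans (y x z : U) :
  val x <=p val y -> val y <=p val z -> val x <=p val z.
Proof. exact: sle_trans. Qed.
Fact sub_sle_add2l (z x y : U) : val x <=p val y -> val (z + x) <=p val (z + y).
Proof. by rewrite !rmorphD; apply: sle_add2l. Qed.
Fact sub_sle_mul2l (z x y : U) : val x <=p val y -> val (z * x) <=p val (z * y).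
Proof. by rewrite !rmorphM; apply: sle_mul2l. Qed.
HB.instance Definition _ := isPreorderedSemiRing.Build U
  sub_sle_refl sub_sle_trans sub_sle_add2l sub_sle_mul2l.

Fact sub_power_universal : power_universal (exist _ u Pu : U).
Proof.
have [u0 u1 uexp] := uP; split=> [||x y x0 y0 xy].
- by rewrite -val_eqE rmorph0.
- by have : val (1 : U) <=p u by rewrite rmorph1.
- have [|||k] := uexp (val x) (val y) => //.
  exists k; have : val y <=p val ((exist _ u Pu : U) ^+ k * x) => //.
  by rewrite rmorphM rmorphXn.
Qed.
HB.instance Definition _ := hasPowerUniversal.Build U sub_power_universal.

Fact sub_sle_anti (x y : U) : x <=p y -> y <=p x -> x = y.
Proof. by move=> xy yx; apply: val_inj; apply: sle_anti. Qed.
HB.instance Definition _ := isPartiallyOrdered.Build U sub_sle_anti.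

Fact val_sle_homo (x y : U) : x <=p y -> val x <=p val y. Proof. by []. Qed.
HB.instance Definition _ :=
  isMonotone.Build U T (val : U -> T) val_sle_homo.

Lemma mul_close_val k (x y : U) :
  mul_close pu k x y <-> mul_close u k (val x) (val y).
Proof.
have valE z : val ((pu : U) ^+ k * z) = u ^+ k * val z.
  by rewrite rmorphM rmorphXn.
by rewrite /mul_close -!valE.
Qed.

Lemma sub_asymp_closed : asymp_closed T -> asymp_closed U.
Proof.
move=> closedT x y [k k0 xy].
apply: (asymp_closed_base closedT uP k0) => n.
have : val (x ^+ n) <=p val ((pu : U) ^+ k n * y ^+ n) by exact: xy.
by rewrite rmorphM !rmorphXn.
Qed.

(** Completeness of [T] supplies a limit [s] in [T]; its powers are close to elements of [P], so the
    first hypothesis puts [s] in [P]. *)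
Lemma sub_asymp_complete :
  (forall (d : nat -> T) (k : nat -> nat) (s : T), (forall n, d n \in P) ->
     sublinear k -> (forall n, mul_close u (k n) (s ^+ n) (d n)) -> s \in P) ->
  asymp_complete T -> asymp_complete U.
Proof.
move=> P_lim completeT a a_neq0 [a0 | [_ [k k0 ak]]]; first by exists 0.
(* Closeness is measured by [u] in the sub-semiring and by [pu] in [T]: [c] serves to move the
   sequence into [T], [c'] to bring the limit back. *)
have [c uc] := power_universal_dominates uP puP.
have [c' puc] := power_universal_dominates puP uP.
have va_neq0 n : val (a n) != 0 by rewrite -(rmorph0 (val : U -> T)) val_eqE.
have [|s /seq_asymp_eqP [l l0 sa]] := completeT (fun n => val (a n)) va_neq0.
  right; split=> //; exists (fun n => c * k n)%N; first exact: sublinearMr.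
  move=> t n t_gt0; have /mul_close_val := ak t n t_gt0.
  rewrite rmorph_prod -big_distrr /= => an.
  exact: mul_close_base uc an.
have {}sa n : mul_close u (c' * l n) (s ^+ n) (val (a n)).
  by apply: mul_close_base puc _; apply: mul_close_sym; apply: sa.
have c'l0 := sublinearMr c' l0.
have sP : s \in P by apply: P_lim c'l0 sa => n; exact: valP.
exists (exist _ s sP : U); apply/seq_asymp_eqP.
exists (fun n => c' * l n)%N => // n; apply/mul_close_sym/mul_close_val.
by rewrite rmorphXn; apply: sa.
Qed.

Section Corestriction.
Variables (R : preorderedSemiRingType) (f : Hom R T).
Hypothesis fP : forall x, f x \in P.

Definition corestrict (x : R) : U := exist _ (f x) (fP x).

Fact corestrict_is_nmod_morphism : nmod_morphism corestrict.
Proof.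
split; first by apply: val_inj; rewrite (rmorph0 (val : U -> T)) /= rmorph0.
by move=> x y; apply: val_inj; rewrite rmorphD /= rmorphD.
Qed.
Fact corestrict_is_monoid_morphism : monoid_morphism corestrict.
Proof.
split; first by apply: val_inj; rewrite (rmorph1 (val : U -> T)) /= rmorph1.
by move=> x y; apply: val_inj; rewrite rmorphM /= rmorphM.
Qed.
Fact corestrict_sle_homo x y : x <=p y -> corestrict x <=p corestrict y.
Proof. exact: sle_homo. Qed.
HB.instance Definition _ :=
  GRing.isNmodMorphism.Build R U corestrict corestrict_is_nmod_morphism.
HB.instance Definition _ :=
  GRing.isMonoidMorphism.Build R U corestrict corestrict_is_monoid_morphism.
HB.instance Definition _ := isMonotone.Build R U corestrict corestrict_sle_homo.

End Corestriction.

End FullSubSemiRing.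

(** * Composite homomorphisms, and the inequality in the completion *)

Section Composition.
Variables (R S T : preorderedSemiRingType) (g : Hom S T) (f : Hom R S).

Fact comp_sle_homo x y : x <=p y -> (g \o f) x <=p (g \o f) y.
Proof. by move=> xy; do 2![apply: sle_homo]. Qed.
HB.instance Definition _ := isMonotone.Build R T (g \o f) comp_sle_homo.

End Composition.

Fact id_sle_homo (S : preorderedSemiRingType) (x y : S) :
  x <=p y -> idfun x <=p idfun y.
Proof. by []. Qed.
HB.instance Definition _ (S : preorderedSemiRingType) :=
  isMonotone.Build S S idfun (@id_sle_homo S).

(* The approximable elements form a closed, asymptotically complete semiring
   through which [i] factors. By the universal property its inclusion into
   [Sbar] has a section, hence is onto. *)
Lemma completion_approximable (S : pgSemiRingType) (Sbar : pgPOSemiRingType)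
    (i : Hom S Sbar) : is_asymp_completion i -> forall a, a \in approximable i.
Proof.
case=> closedS completeS ipuP univ a.
pose U := sub_semiring (approximable_semiring_closed i) ipuP
  (approximable_image i pu).
have [||g ig _] := univ U _ _ (corestrict _ _ _ (approximable_image i)).
- exact: sub_asymp_closed.
- exact: sub_asymp_complete (@approximable_limit _ _ i) completeS.
have [h _ h_uniq] := univ Sbar closedS completeS i.
have val_gi : i =1 (val \o g) \o i.
  by move=> x; rewrite /= -[g (i x)]ig.
(* Both [idfun] and [val \o g] extend [i], so both agree with [h]. *)
have <- : val (g a) = a.
  have idE : a = h a by exact: (h_uniq idfun).
  by rewrite [RHS]idE; exact: (h_uniq (val \o g)).
exact: valP.
Qed.

Theorem theorem4p1
    (KK : pgPOSemiRingType -> Prop)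
    (KK_closed : forall K, KK K -> asymp_closed K)
    (KK_complete : forall K, KK K -> asymp_complete K)
    (S : pgSemiRingType)
    (S_spectrum : forall a b : S,
      asymp_le a b <->
      (forall K, KK K -> forall phi : Hom S K, phi a <=p phi b))
    (Sbar : pgPOSemiRingType) (i : Hom S Sbar)
    (i_completion : is_asymp_completion i)
    (a b : Sbar) (ab : order_equiv a b) :
  a <=p b <->
  (forall K, KK K -> forall psi : Hom Sbar K, psi a <=p psi b).
Proof.
split=> [a_le_b K _ psi | psi_ab]; first exact: sle_homo.
have /approximableP [k k0 ax] := completion_approximable i_completion a.
have /approximableP [l l0 bx] := completion_approximable i_completion b.
have [closedS _ ipuP univ] := i_completion.
have ipu_exp n x : i (pu ^+ n * x) = i pu ^+ n * i x.
  by rewrite rmorphM rmorphXn.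
have kl0 := sublinearD k0 l0.
(* The exponent is spent as [k n] from [a ^+ n] to [i x], [k n + l n] from [i x] to [i y], and [l n]
   from [i y] to [b ^+ n]. *)
apply: (asymp_closed_base closedS ipuP (sublinearD kl0 kl0)) => n.
have [x [axn xan]] := ax n; have [y [byn ybn]] := bx n.
have xy : i x <=p i pu ^+ (k n + l n) * i y.
  rewrite -ipu_exp.
  (* Here [n] is fixed and the error factor is part of an element of [S], so nothing is asked of the
     image of [pu] in [K]. *)
  have [m m0 xym] : asymp_le x (pu ^+ (k n + l n) * y).
    apply/S_spectrum => K KK_K phi.
    have [psi phiE _] := univ K (KK_closed K KK_K) (KK_complete K KK_K) phi.
    rewrite !phiE /= ipu_exp; apply: sle_trans (sle_homo _ _ xan) _.
    rewrite exprD -mulrA ![psi (i pu ^+ k n * _)]rmorphM; apply: sle_mul2l.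
    apply: (sle_trans (y := psi (b ^+ n))); last exact: sle_homo.
    by rewrite !rmorphXn; apply: sle_exp; apply: psi_ab.
  (* Closedness of [Sbar] removes the second asymptotic error [m], which depends on [n] and so could
     not be carried along. *)
  apply: (asymp_closed_base closedS ipuP m0) => j.
  by have := sle_homo (s := i) _ _ (xym j); rewrite ipu_exp !rmorphXn.
apply: sle_trans axn _.
have -> : (k n + l n + (k n + l n) = k n + (k n + l n + l n))%N by lia.
rewrite exprD -mulrA; apply: sle_mul2l; apply: sle_trans xy _.
by rewrite [in X in _ <=p X]exprD -mulrA; apply: sle_mul2l.
Qed.
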